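(* There is a dual equivalence between the category $\mathsf{mOL}$ of monadic ortholattices and the full subcategory of the category $\mathsf{mOS}$ of monadic orthospaces consisting of the ortho-sober monadic orthospaces.
   Context: An ortholattice is a bounded lattice with an order-inverting complementation $'$ of period two. A monadic ortholattice is an ortholattice with a quantifier $\exists$, i.e. a closure operator (order preserving, $a\le\exists a$, $\exists\exists a=\exists a$) such that the orthocomplement of each closed element is closed. $\mathsf{mOL}$ is the category of monadic ortholattices and homomorphisms (ortholattice homomorphisms preserving $\exists$). An orthoframe is a set $X$ with an irreflexive symmetric relation $\perp$. For $S\subseteq X$, $S^\perp=\{y\in X:x\perp y\text{ for all }x\in S\}$; $S$ is bi-orthogonally closed if $S=S^{\perp\perp}$. For a binary relation $R$ on $X$ and $A\subseteq X$, $R[A]=\{y\in X:x\,R\,y\text{ for some }x\in A\}$. A monadic orthoframe is $(X,\perp,R)$ with $(X,\perp)$ an orthoframe and $R$ reflexive, transitive, with $R[R[\{x\}]^\perp]\subseteq R[\{x\}]^\perp$ for all $x\in X$. An orthospace $(X,\perp,\le,\tau)$ is an orthoframe $(X,\perp)$ with a partial ordering $\le$ and a compact topology $\tau$ such that, writing $\mathcal{C}(X)$ for the set of clopen bi-orthogonally closed subsets of $X$: (1) if $x\nleq y$ then there is $U\in\mathcal{C}(X)$ with $x\in U$, $y\notin U$; (2) if $x\perp z$ and $x\le y$ then $y\perp z$; (3) if $U\in\mathcal{C}(X)$ then $U^\perp\in\mathcal{C}(X)$; (4) if $x\perp y$ then there is $U\in\mathcal{C}(X)$ with $x\in U$, $y\in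 U^\perp$. For an orthospace $X$, $\mathcal{C}(X)$ is an ortholattice under inclusion with orthocomplement $U\mapsto U^\perp$. An orthospace morphism $\phi:P\to X$ is a continuous map such that: if $\phi(p)\perp\phi(q)$ then $p\perp q$; and if $x\not\perp\phi(p)$ then there exists $q$ with $q\not\perp p$ and $\phi(q)\in\{x\}^{\perp\perp}$. A monadic orthospace $(X,\perp,\le,R,\tau)$ is such that $(X,\perp,\le,\tau)$ is an orthospace, $(X,\perp,R)$ is a monadic orthoframe, and $R[U]\in\mathcal{C}(X)$ for each $U\in\mathcal{C}(X)$. A monadic orthospace morphism $\phi:X\to Y$ is an orthospace morphism with $R[\phi^{-1}[U]]=\phi^{-1}[R[U]]$ for each $U\in\mathcal{C}(Y)$ (with $R$ denoting the relation of $X$, respectively of $Y$). $\mathsf{mOS}$ is the category of monadic orthospaces and their morphisms. A (monadic) orthospace $X$ is ortho-sober if each proper (non-empty) filter of the ortholattice $\mathcal{C}(X)$ is equal to $\{U\in\mathcal{C}(X):x\in U\}$ for some $x\in X$. *)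

(* Defs.v *)
From HB Require Import structures.
From mathcomp Require Import all_boot all_order.
From mathcomp Require Import mathcomp_extra boolp classical_sets.
From mathcomp Require Import topology.

Set Implicit Arguments.
Unset Strict Implicit.
Unset Printing Implicit Defensive.

Import Order.TTheory.
Local Open Scope classical_set_scope.
Local Open Scope order_scope.

(** * Categories *)

Record category := Category {
  cat_ob :> Type;
  cat_hom : cat_ob -> cat_ob -> Type;
  cat_id : forall X, cat_hom X X;
  cat_comp : forall X Y Z, cat_hom Y Z -> cat_hom X Y -> cat_hom X Z;
  cat_idl : forall X Y (f : cat_hom X Y), cat_comp (cat_id Y) f = f;
  cat_idr : forall X Y (f : cat_hom X Y), cat_comp f (cat_id X) = f;
  cat_assoc : forall W X Y Z
    (h : cat_hom Y Z) (g : cat_hom X Y) (f : cat_hom W X),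
    cat_comp h (cat_comp g f) = cat_comp (cat_comp h g) f
}.
Arguments cat_hom {c} _ _.
Arguments cat_id {c} _.
Arguments cat_comp {c X Y Z} _ _.

Definition opposite (C : category) : category :=
  @Category C (fun X Y => cat_hom Y X) (fun X => cat_id X)
    (fun _ _ _ g f => cat_comp f g)
    (fun _ _ f => cat_idr f) (fun _ _ f => cat_idl f)
    (fun _ _ _ _ h g f => esym (cat_assoc f g h)).

Definition full_subcategory (C : category) (P : C -> Prop) : category :=
  @Category {X : C | P X} (fun X Y => cat_hom (sval X) (sval Y))
    (fun X => cat_id (sval X))
    (fun _ _ _ g f => cat_comp g f)
    (fun _ _ f => cat_idl f) (fun _ _ f => cat_idr f)
    (fun _ _ _ _ h g f => cat_assoc h g f).

Record functor (C D : category) := Functor {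
  fun_ob :> C -> D;
  fun_hom : forall X Y : C, cat_hom X Y -> cat_hom (fun_ob X) (fun_ob Y);
  fun_id : forall X : C, fun_hom (cat_id X) = cat_id (fun_ob X);
  fun_comp : forall (X Y Z : C) (g : cat_hom Y Z) (f : cat_hom X Y),
    fun_hom (cat_comp g f) = cat_comp (fun_hom g) (fun_hom f)
}.
Arguments fun_hom {C D} _ {X Y} _.

Definition functor_id (C : category) : functor C C :=
  @Functor C C (fun X => X) (fun _ _ f => f) (fun _ => erefl)
    (fun _ _ _ _ _ => erefl).

Section FunctorComp.
Variables (C D E : category) (G : functor D E) (F : functor C D).

Let comp_id (X : C) : fun_hom G (fun_hom F (cat_id X)) = cat_id (G (F X)).
Proof. by rewrite !fun_id. Qed.

Let comp_comp (X Y Z : C) (g : cat_hom Y Z) (f : cat_hom X Y) :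
  fun_hom G (fun_hom F (cat_comp g f)) =
  cat_comp (fun_hom G (fun_hom F g)) (fun_hom G (fun_hom F f)).
Proof. by rewrite !fun_comp. Qed.

Definition functor_comp : functor C E :=
  @Functor C E (fun X => G (F X)) (fun _ _ f => fun_hom G (fun_hom F f))
    comp_id comp_comp.

End FunctorComp.

Definition is_iso (C : category) (X Y : C) (f : cat_hom X Y) : Prop :=
  exists g : cat_hom Y X,
    cat_comp g f = cat_id X /\ cat_comp f g = cat_id Y.

Definition naturally_isomorphic (C D : category) (F G : functor C D) : Prop :=
  exists eta : forall X : C, cat_hom (F X) (G X),
    (forall X, is_iso (eta X)) /\
    (forall (X Y : C) (f : cat_hom X Y),
      cat_comp (eta Y) (fun_hom F f) = cat_comp (fun_hom G f) (eta X)).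

Definition equivalent (C D : category) : Prop :=
  exists (F : functor C D) (G : functor D C),
    naturally_isomorphic (functor_comp G F) (functor_id C) /\
    naturally_isomorphic (functor_comp F G) (functor_id D).

Definition dually_equivalent (C D : category) : Prop :=
  equivalent (opposite C) D.

(** * Monadic ortholattices *)

(** The display [d] only selects notations, so the objects of [mOL] and [mOS]
    below range over all displays. *)

HB.mixin Record isOrtholattice (d : Order.disp_t) T of Order.TBLattice d T := {
  ocompl : T -> T;
  ocomplK : involutive ocompl;
  le_ocompl : {homo ocompl : x y /~ x <= y};
  meet_ocompl : forall x, x `&` ocompl x = \bot;
  join_ocompl : forall x, x `|` ocompl x = \top
}.

#[short(type="ortholatticeType")]
HB.structure Definition Ortholattice d :=
  {T of isOrtholattice d T & Order.TBLattice d T}.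

(** [quant] is the quantifier; its closed elements are its fixed points. *)
HB.mixin Record isMonadicOrtholattice (d : Order.disp_t) T
    of Ortholattice d T := {
  quant : T -> T;
  quant_homo : {homo quant : x y / x <= y};
  le_quant : forall x, x <= quant x;
  quant_idem : forall x, quant (quant x) = quant x;
  quant_ocompl : forall x : T, quant x = x -> quant (ocompl x) = ocompl x
}.

#[short(type="monadicOrtholatticeType")]
HB.structure Definition MonadicOrtholattice d :=
  {T of isMonadicOrtholattice d T & Ortholattice d T}.

Record monadic_ortholattice_morphism d d' (L : monadicOrtholatticeType d)
    (M : monadicOrtholatticeType d') (f : L -> M) : Prop := {
  mol_meet : Order.meet_morphism f;
  mol_join : Order.join_morphism f;
  mol_bot : f \bot = \bot;
  mol_top : f \top = \top;
  mol_ocompl : {morph f : x / ocompl x};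
  mol_quant : {morph f : x / quant x}
}.

Record proper_filter d (L : tbLatticeType d) (F : set L) : Prop := {
  pfilter_neq0 : F !=set0;
  pfilter_up : forall x y, F x -> x <= y -> F y;
  pfilter_meet : forall x y, F x -> F y -> F (x `&` y);
  pfilter_proper : F <> setT
}.

Lemma mol_morphism_id d (L : monadicOrtholatticeType d) :
  monadic_ortholattice_morphism (@idfun L).
Proof. by split. Qed.

Lemma mol_morphism_comp d1 d2 d3 (L : monadicOrtholatticeType d1)
    (M : monadicOrtholatticeType d2) (N : monadicOrtholatticeType d3)
    (g : M -> N) (f : L -> M) :
  monadic_ortholattice_morphism g -> monadic_ortholattice_morphism f ->
  monadic_ortholattice_morphism (g \o f).
Proof.
move=> [gI gU g0 g1 gC gQ] [fI fU f0 f1 fC fQ]; split => [x y|x y|||x|x] /=.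
- by rewrite fI gI.
- by rewrite fU gU.
- by rewrite f0.
- by rewrite f1.
- by rewrite fC gC.
- by rewrite fQ gQ.
Qed.

Record mOL_ob := MOLOb {
  mOL_disp : Order.disp_t;
  mOL_sort :> monadicOrtholatticeType mOL_disp
}.

Definition mOL_hom (L M : mOL_ob) : Type :=
  {f : L -> M | monadic_ortholattice_morphism f}.

Definition mOL : category.
Proof.
refine (@Category mOL_ob mOL_hom
  (fun L => exist _ idfun (mol_morphism_id L))
  (fun L M N g f => exist _ (sval g \o sval f)
     (mol_morphism_comp (svalP g) (svalP f))) _ _ _).
- by move=> X Y [f fP]; exact: eq_exist.
- by move=> X Y [f fP]; exact: eq_exist.
- by move=> W X Y Z [h hP] [g gP] [f fP]; exact: eq_exist.
Defined.

(** * Monadic orthoframes *)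

(** [perp] is the orthogonality relation, [orthoc S] the set of points
    orthogonal to all of [S], and [acc] the relation R of a monadic
    orthoframe. *)

HB.mixin Record isOrthoframe T := {
  perp : T -> T -> Prop;
  perp_irr : forall x, ~ perp x x;
  perp_sym : forall x y, perp x y -> perp y x
}.

#[short(type="orthoframeType")]
HB.structure Definition Orthoframe := {T of isOrthoframe T}.

Definition orthoc (X : orthoframeType) (S : set X) : set X :=
  [set y | forall x, S x -> perp x y].

Definition biorth_closed (X : orthoframeType) (S : set X) : Prop :=
  S = orthoc (orthoc S).

Definition rel_image (X : Type) (R : X -> X -> Prop) (A : set X) : set X :=
  [set y | exists2 x, A x & R x y].

HB.mixin Record isMonadicOrthoframe T of Orthoframe T := {
  acc : T -> T -> Prop;
  acc_refl : forall x, acc x x;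
  acc_trans : forall x y z, acc x y -> acc y z -> acc x z;
  acc_orthoc : forall x : T,
    rel_image acc (orthoc (rel_image acc [set x])) `<=`
    orthoc (rel_image acc [set x])
}.

#[short(type="monadicOrthoframeType")]
HB.structure Definition MonadicOrthoframe :=
  {T of isMonadicOrthoframe T & Orthoframe T}.

(** * Monadic orthospaces *)

(** [POrderedTopological] imposes no compatibility between the order and the
    topology, and [compact] does not include the Hausdorff property. *)

HB.structure Definition TopologicalOrthoframe :=
  {T of Orthoframe T & Topological T}.

Definition clopen_biorth (X : TopologicalOrthoframe.type) (U : set X) : Prop :=
  clopen U /\ biorth_closed U.

HB.mixin Record isOrthospace (d : Order.disp_t) T
    of TopologicalOrthoframe T & POrderedTopological d T := {
  orthospace_compact : compact [set: T];
  orthospace_sep : forall x y : T, ~ (x <= y) ->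
    exists U : set T, [/\ clopen_biorth U, U x & ~ U y];
  orthospace_le_perp : forall x y z : T, perp x z -> x <= y -> perp y z;
  orthospace_orthoc : forall U : set T,
    clopen_biorth U -> clopen_biorth (orthoc U);
  orthospace_perp : forall x y : T, perp x y ->
    exists U : set T, [/\ clopen_biorth U, U x & orthoc U y]
}.

#[short(type="orthospaceType")]
HB.structure Definition Orthospace d :=
  {T of isOrthospace d T & TopologicalOrthoframe T & POrderedTopological d T}.

HB.mixin Record isMonadicOrthospace (d : Order.disp_t) T
    of Orthospace d T & MonadicOrthoframe T := {
  acc_clopen_biorth : forall U : set T,
    clopen_biorth U -> clopen_biorth (rel_image acc U)
}.

#[short(type="monadicOrthospaceType")]
HB.structure Definition MonadicOrthospace d :=
  {T of isMonadicOrthospace d T & Orthospace d T & MonadicOrthoframe T}.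

Section Orthoc.
Variable X : orthoframeType.
Implicit Types S T : set X.

Lemma orthocS S T : S `<=` T -> orthoc T `<=` orthoc S.
Proof. by move=> ST y Ty x /ST /Ty. Qed.

Lemma sub_orthoc2 S : S `<=` orthoc (orthoc S).
Proof. by move=> x Sx y /(_ _ Sx); exact: perp_sym. Qed.

Lemma orthoc3 S : orthoc (orthoc (orthoc S)) = orthoc S.
Proof.
by apply/seteqP; split; [exact/orthocS/sub_orthoc2|exact: sub_orthoc2].
Qed.

Lemma orthoc0 : orthoc (set0 : set X) = setT.
Proof. by apply/seteqP; split => // x _ y. Qed.

Lemma orthocT : orthoc [set: X] = set0.
Proof. by apply/seteqP; split => // x /(_ x I) /perp_irr. Qed.

Lemma orthocI S : (S `&` orthoc S)%classic = set0.
Proof. by apply/seteqP; split => // x [Sx /(_ x Sx) /perp_irr]. Qed.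

Lemma orthoc2S S T : S `<=` T -> orthoc (orthoc S) `<=` orthoc (orthoc T).
Proof. by move=> ST; exact/orthocS/orthocS. Qed.

Lemma biorth_closedI S T :
  biorth_closed S -> biorth_closed T -> biorth_closed (S `&` T)%classic.
Proof.
move=> clS clT; apply/seteqP; split; first exact: sub_orthoc2.
move=> x STx; split; [rewrite clS|rewrite clT]; move: x STx.
  by apply: orthoc2S => ? [].
by apply: orthoc2S => ? [].
Qed.

End Orthoc.

(** ** The ortholattice of clopen bi-orthogonally closed sets *)

Record clopenBiorth d (X : orthospaceType d) := ClopenBiorth {
  cb_set :> set X;
  cb_setP : `[<clopen_biorth cb_set>]
}.

HB.instance Definition _ d (X : orthospaceType d) := [isSub for @cb_set d X].
HB.instance Definition _ d (X : orthospaceType d) :=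
  [Choice of clopenBiorth X by <:].

Section ClopenBiorthOrtholattice.
Context {d : Order.disp_t} {X : orthospaceType d}.
Implicit Types U V W : clopenBiorth X.

Lemma clopenBiorthP U : clopen_biorth U.
Proof. exact/asboolP/cb_setP. Qed.

Definition mk_clopenBiorth (S : set X) (SP : clopen_biorth S) :
  clopenBiorth X := ClopenBiorth (asboolT SP).

Lemma clopenBiorth_inj U V : U = V :> set X -> U = V.
Proof. exact: val_inj. Qed.

Lemma clopen_biorthI (S T : set X) :
  clopen_biorth S -> clopen_biorth T -> clopen_biorth (S `&` T)%classic.
Proof.
by move=> [cS bS] [cT bT]; split; [exact: clopenI|exact: biorth_closedI].
Qed.

Lemma clopen_biorth0 : clopen_biorth (set0 : set X).
Proof. by split; [exact: clopen0|rewrite /biorth_closed orthoc0 orthocT]. Qed.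

Lemma clopen_biorthT : clopen_biorth [set: X].
Proof. by split; [exact: clopenT|rewrite /biorth_closed orthocT orthoc0]. Qed.

Definition cb_le U V : bool := `[<(U : set X) `<=` V>].
Definition cb_bot := mk_clopenBiorth clopen_biorth0.
Definition cb_top := mk_clopenBiorth clopen_biorthT.
Definition cb_orthoc U :=
  mk_clopenBiorth (orthospace_orthoc _ (clopenBiorthP U)).
Definition cb_meet U V :=
  mk_clopenBiorth (clopen_biorthI (clopenBiorthP U) (clopenBiorthP V)).
Definition cb_join U V := cb_orthoc (cb_meet (cb_orthoc U) (cb_orthoc V)).

Lemma cb_le_refl : reflexive cb_le.
Proof. by move=> U; apply/asboolP. Qed.

Lemma cb_le_anti : antisymmetric cb_le.
Proof.
by move=> U V /andP[/asboolP UV /asboolP VU]; apply/clopenBiorth_inj/seteqP.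
Qed.

Lemma cb_le_trans : transitive cb_le.
Proof.
by move=> V U W /asboolP UV /asboolP VW; apply/asboolP => x /UV /VW.
Qed.

HB.instance Definition _ := Order.Le_isPOrder.Build set_display
  (clopenBiorth X) cb_le_refl cb_le_anti cb_le_trans.

Lemma cb_leP U V : reflect ((U : set X) `<=` V) (U <= V).
Proof. exact: asboolP. Qed.

Lemma cb_meetP W U V : (W <= cb_meet U V) = (W <= U) && (W <= V).
Proof.
apply/cb_leP/andP => [WUV|[/cb_leP WU /cb_leP WV] x Wx].
  by split; apply/cb_leP => x /WUV [].
by split; [exact: WU|exact: WV].
Qed.

Lemma cb_orthocK : involutive cb_orthoc.
Proof.
by move=> U; apply/clopenBiorth_inj => /=; have [_ <-] := clopenBiorthP U.
Qed.

Lemma cb_le_orthoc : {homo cb_orthoc : U V /~ U <= V}.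
Proof. by move=> U V /cb_leP UV; apply/cb_leP/orthocS. Qed.

Lemma cb_joinP U V W : (cb_join U V <= W) = (U <= W) && (V <= W).
Proof.
have leC A B : (cb_orthoc A <= cb_orthoc B) = (B <= A).
  apply/idP/idP; last exact: cb_le_orthoc.
  by move=> /cb_le_orthoc; rewrite !cb_orthocK.
by rewrite -[W in LHS]cb_orthocK leC cb_meetP !leC.
Qed.

HB.instance Definition _ := Order.POrder_MeetJoin_isLattice.Build set_display
  (clopenBiorth X) cb_meetP cb_joinP.

Lemma cb_le0x U : cb_bot <= U.
Proof. exact/cb_leP. Qed.

Lemma cb_lex1 U : U <= cb_top.
Proof. exact/cb_leP. Qed.

HB.instance Definition _ :=
  Order.hasBottom.Build set_display (clopenBiorth X) cb_le0x.
HB.instance Definition _ :=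
  Order.hasTop.Build set_display (clopenBiorth X) cb_lex1.

Lemma cb_meet_orthoc U : U `&` cb_orthoc U = \bot.
Proof. by apply/clopenBiorth_inj; rewrite /= orthocI. Qed.

Lemma cb_join_orthoc U : U `|` cb_orthoc U = \top.
Proof.
apply/clopenBiorth_inj => /=; have [_ <-] := clopenBiorthP U.
by rewrite setIC orthocI orthoc0.
Qed.

HB.instance Definition _ := isOrtholattice.Build set_display (clopenBiorth X)
  cb_orthocK cb_le_orthoc cb_meet_orthoc cb_join_orthoc.

End ClopenBiorthOrtholattice.

Definition ortho_sober d (X : orthospaceType d) : Prop :=
  forall F : set (clopenBiorth X), proper_filter F ->
    exists x : X, F = [set U : clopenBiorth X | (U : set X) x].

(** ** Morphisms *)

(** [acc] is only required to commute with preimages of clopen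
    bi-orthogonally closed sets: isomorphisms of monadic orthospaces need not
    preserve [acc] pointwise. *)

Record orthospace_morphism d d' (P : orthospaceType d) (X : orthospaceType d')
    (phi : P -> X) : Prop := {
  osm_continuous : continuous phi;
  osm_perp : forall p q, perp (phi p) (phi q) -> perp p q;
  osm_back : forall x p, ~ perp x (phi p) ->
    exists2 q, ~ perp q p & orthoc (orthoc [set x]) (phi q)
}.

Record monadic_orthospace_morphism d d' (X : monadicOrthospaceType d)
    (Y : monadicOrthospaceType d') (phi : X -> Y) : Prop := {
  mosm_orthospace : orthospace_morphism phi;
  mosm_acc : forall U : set Y, clopen_biorth U ->
    rel_image acc (phi @^-1` U) = phi @^-1` rel_image acc U
}.

Section OrthospaceMorphism.
Context {d d' : Order.disp_t} {P : orthospaceType d} {X : orthospaceType d'}.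
Variables (phi : P -> X) (phiP : orthospace_morphism phi).

Lemma osm_orthoc (U : set X) : biorth_closed U ->
  phi @^-1` orthoc U = orthoc (phi @^-1` U).
Proof.
move=> clU; apply/seteqP; split => p Up; first by move=> q /Up/(osm_perp phiP).
move=> x Ux; apply: contrapT => /(osm_back phiP) [q nqp xq].
apply/nqp/Up; rewrite /= clU.
by move: xq; apply: orthoc2S => _ ->.
Qed.

Lemma osm_clopen_biorth (U : set X) :
  clopen_biorth U -> clopen_biorth (phi @^-1` U).
Proof.
move=> [cU bU]; split.
  exact: preimage_clopen (osm_continuous phiP).
rewrite /biorth_closed -osm_orthoc// -osm_orthoc -?bU//.
by rewrite /biorth_closed orthoc3.
Qed.

End OrthospaceMorphism.

Lemma os_morphism_id d (X : orthospaceType d) :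
  orthospace_morphism (@idfun X).
Proof.
split => // [x|x p xp]; first exact.
by exists x => //; exact: sub_orthoc2.
Qed.

Lemma os_morphism_comp d1 d2 d3 (X : orthospaceType d1) (Y : orthospaceType d2)
    (Z : orthospaceType d3) (psi : Y -> Z) (phi : X -> Y) :
  orthospace_morphism psi -> orthospace_morphism phi ->
  orthospace_morphism (psi \o phi).
Proof.
move=> psiP phiP; split.
- move=> x; apply: continuous_comp; first exact: (osm_continuous phiP).
  exact: (osm_continuous psiP).
- by move=> p q /= /(osm_perp psiP) /(osm_perp phiP).
- move=> z p /= /(osm_back psiP) [y nyp zy].
  have [q nqp yq] := osm_back phiP nyp.
  exists q => // t zt; apply: contrapT => /(osm_back psiP) [w nwq tw].
  apply/nwq/yq => _ ->; apply: (osm_perp psiP).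
  apply: perp_sym; apply: zy => _ ->.
  by apply: tw => _ ->; exact/perp_sym/zt.
Qed.

Lemma mos_morphism_id d (X : monadicOrthospaceType d) :
  monadic_orthospace_morphism (@idfun X).
Proof. by split; [exact: os_morphism_id|]. Qed.

Lemma mos_morphism_comp d1 d2 d3 (X : monadicOrthospaceType d1)
    (Y : monadicOrthospaceType d2) (Z : monadicOrthospaceType d3)
    (psi : Y -> Z) (phi : X -> Y) :
  monadic_orthospace_morphism psi -> monadic_orthospace_morphism phi ->
  monadic_orthospace_morphism (psi \o phi).
Proof.
move=> [psiP psiR] [phiP phiR]; split; first exact: os_morphism_comp.
move=> U cU; rewrite [LHS](phiR (psi @^-1` U)) ?psiR//.
exact: osm_clopen_biorth.
Qed.

Record mOS_ob := MOSOb {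
  mOS_disp : Order.disp_t;
  mOS_sort :> monadicOrthospaceType mOS_disp
}.

Definition mOS_hom (X Y : mOS_ob) : Type :=
  {phi : X -> Y | monadic_orthospace_morphism phi}.

Definition mOS : category.
Proof.
refine (@Category mOS_ob mOS_hom
  (fun X => exist _ idfun (mos_morphism_id X))
  (fun X Y Z psi phi => exist _ (sval psi \o sval phi)
     (mos_morphism_comp (svalP psi) (svalP phi))) _ _ _).
- by move=> X Y [f fP]; exact: eq_exist.
- by move=> X Y [f fP]; exact: eq_exist.
- by move=> W X Y Z [h hP] [g gP] [f fP]; exact: eq_exist.
Defined.

(* Main.v *)
From HB Require Import structures.
From mathcomp Require Import all_boot all_order.
From mathcomp Require Import boolp classical_sets.
From mathcomp Require Import topology.
Require Import Defs.

(** This is a Stone duality in which points are arbitrary proper filters rather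
    than prime ones: without distributivity there may be too few prime filters,
    but the principal filters already separate elements.

    The dual of a lattice [L] is the set of its proper filters, ordered by
    inclusion, with [x] orthogonal to [y] when some [a] in [x] has its
    orthocomplement in [y], and with [y] accessible from [x] when [quant a]
    is in [y] for all [a] in [x].  Its topology is generated by the sets
    [stone_set a] of filters containing [a] and by their complements.  The dual
    of a space [X] is the lattice of its clopen bi-orthogonally closed sets,
    quantified by the image under [acc].  On morphisms both functors take
    preimages.

    The map [stone_set] turns lattice operations into operations on sets
    ([stone_meet], [orthoc_stone_set], [acc_stone_set]).  For the last two, one
    inclusion is formal, and the other one uses the principal filter of [a],
    the least point of [stone_set a].  That point also shows that [stone_set]
    is injective, and every clopen bi-orthogonally closed set is of this form
    by compactness ([clopen_biorth_stone_set]).  Hence [L] is isomorphic to the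
    lattice of its dual.

    In the other direction, a point [x] of an orthospace defines the filter
    [point_filter x] of the clopen bi-orthogonally closed sets around it.  The
    axioms of an orthospace make this map injective, continuous, and both
    preserving and reflecting orthogonality; ortho-sobriety is surjectivity.
    Its inverse is continuous because [X] is compact and the filter space is
    Hausdorff.  The map need not reflect [acc] pointwise, but the morphism
    condition speaks only about images of clopen bi-orthogonally closed sets,
    and these correspond on both sides. *)

Set Implicit Arguments.
Unset Strict Implicit.
Unset Printing Implicit Defensive.

Import Order.TTheory.
Local Open Scope classical_set_scope.
Local Open Scope order_scope.

(** * Ortholattices and quantifiers *)

Section OrtholatticeTheory.
Context {d : Order.disp_t} {L : ortholatticeType d}.
Implicit Types a b : L.

Lemma ocompl_bot : ocompl (\bot : L) = \top.
Proof. by rewrite -[LHS](join0x (ocompl _)) join_ocompl. Qed.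

Lemma ocompl_top : ocompl (\top : L) = \bot.
Proof. by rewrite -ocompl_bot ocomplK. Qed.

Lemma ocompl_join a b : ocompl (a `|` b) = ocompl a `&` ocompl b.
Proof.
apply: le_anti; rewrite lexI !le_ocompl ?leUl ?leUr//=.
rewrite -[X in X <= _]ocomplK le_ocompl// leUx.
by rewrite -{1}[a]ocomplK le_ocompl ?leIl// -{1}[b]ocomplK le_ocompl ?leIr.
Qed.

End OrtholatticeTheory.

Section QuantifierTheory.
Context {d : Order.disp_t} {L : monadicOrtholatticeType d}.
Implicit Types a b : L.

(** The top element is closed because it lies below its own closure, hence
    so is its orthocomplement. *)
Lemma quant_bot : quant (\bot : L) = \bot.
Proof.
rewrite -ocompl_top; apply: quant_ocompl.
by apply: le_anti; rewrite lex1 le_quant.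
Qed.

Lemma quant_ocompl_quant a : quant (ocompl (quant a)) = ocompl (quant a).
Proof. by rewrite quant_ocompl// quant_idem. Qed.

End QuantifierTheory.

Section ProperFilterTheory.
Context {d : Order.disp_t} {L : tbLatticeType d}.
Implicit Types F : set L.

Lemma proper_filter_top F : proper_filter F -> F \top.
Proof. by case=> -[a Fa] Fup _ _; exact: Fup Fa (lex1 a). Qed.

Lemma proper_filter_bot F : proper_filter F -> ~ F \bot.
Proof.
case=> _ Fup _ FT F0; apply: FT; apply/seteqP; split=> // a _.
exact: Fup F0 (le0x a).
Qed.

Lemma proper_filter_intro F : F \top ->
  (forall a b, F a -> a <= b -> F b) ->
  (forall a b, F a -> F b -> F (a `&` b)) -> ~ F \bot -> proper_filter F.
Proof.
move=> F1 Fup FI F0; split=> //; first by exists \top.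
by move=> FT; apply: F0; rewrite FT.
Qed.

Lemma proper_filter_up (a : L) : a <> \bot ->
  proper_filter [set b | a <= b].
Proof.
move=> a0; apply: proper_filter_intro => [|b c|b c|] /=.
- exact: lex1.
- exact: le_trans.
- by move=> ab ac; rewrite lexI ab ac.
- by rewrite lex0 => /eqP.
Qed.

End ProperFilterTheory.

(** * The space of proper filters *)

(** The carrier is a subtype of [set L] cut out by a boolean predicate, so that
    a point is determined by its set and the choice structure is inherited. *)
Record filterSpace d (L : tbLatticeType d) := FilterPoint {
  fs_set :> L -> Prop;
  fs_setP : `[<proper_filter fs_set>]
}.

HB.instance Definition _ d (L : tbLatticeType d) := 
  [isSub for (@fs_set d L : filterSpace L -> set L)].
HB.instance Definition _ d (L : tbLatticeType d) :=
  [Choice of filterSpace L by <:].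

Section FilterSpaceOrderTopology.
Context {d : Order.disp_t} {L : tbLatticeType d}.
Implicit Types (x y : filterSpace L) (a b : L).

Lemma filterSpaceP x : proper_filter (fs_set x).
Proof. exact/asboolP/fs_setP. Qed.

Definition mk_filterSpace (F : set L) (FP : proper_filter F) :
  filterSpace L := FilterPoint (asboolT FP).

Lemma filterSpace_inj x y : fs_set x = fs_set y -> x = y.
Proof. exact: val_inj. Qed.

Lemma filterSpace_top x : x \top.
Proof. exact: proper_filter_top (filterSpaceP x). Qed.

Lemma filterSpace_bot x : ~ x \bot.
Proof. exact: proper_filter_bot (filterSpaceP x). Qed.

Lemma filterSpace_up x a b : x a -> a <= b -> x b.
Proof. exact: (pfilter_up (filterSpaceP x)). Qed.

Lemma filterSpace_meet x a b : x a -> x b -> x (a `&` b).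
Proof. exact: (pfilter_meet (filterSpaceP x)). Qed.

Definition fs_le x y : bool := `[<fs_set x `<=` fs_set y>].

Lemma fs_le_refl : reflexive fs_le.
Proof. by move=> x; apply/asboolP. Qed.

Lemma fs_le_anti : antisymmetric fs_le.
Proof.
by move=> x y /andP[/asboolP xy /asboolP yx]; apply/filterSpace_inj/seteqP.
Qed.

Lemma fs_le_trans : transitive fs_le.
Proof.
by move=> y x z /asboolP xy /asboolP yz; apply/asboolP => a /xy /yz.
Qed.

HB.instance Definition _ := Order.Le_isPOrder.Build set_display
  (filterSpace L) fs_le_refl fs_le_anti fs_le_trans.

Lemma fs_leP x y : reflect (fs_set x `<=` fs_set y) (x <= y).
Proof. exact: asboolP. Qed.

Definition stone_set a : set (filterSpace L) := [set x | x a].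

Definition stone_subbase : set (set (filterSpace L)) :=
  [set A | exists a, A = stone_set a \/ A = ~` stone_set a].

HB.instance Definition _ :=
  isSubBaseTopological.Build (filterSpace L) stone_subbase id.

Lemma stone_subbase_open A : stone_subbase A -> open A.
Proof.
move=> SA; exists [set A]; last by rewrite bigcup_set1.
by move=> _ ->; exact: finI_from1.
Qed.

Lemma stone_set_clopen a : clopen (stone_set a).
Proof.
split; first by apply: stone_subbase_open; exists a; left.
by rewrite -openC; apply: stone_subbase_open; exists a; right.
Qed.

(** Neighborhoods are generated by finite intersections of subbasic sets, so
    convergence can be tested on the subbase. *)
Lemma filterSpace_cvg (F : set_system (filterSpace L)) x : Filter F ->
  (forall a, x a -> F (stone_set a)) ->
  (forall a, ~ x a -> F (~` stone_set a)) -> F --> x.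
Proof.
move=> FF Fin Fout A; rewrite nbhsE => -[_ [[B BI <-] [C BC Cx]] sA].
apply: filterS sA _; suff FC : F C by apply: filterS FC => y Cy; exists C.
have [D DS DC] := BI C BC; rewrite -DC; apply: filter_bigI => S DS'.
have : S x by move: Cx; rewrite -DC; apply.
by have /set_mem[a [->|->]] := DS S DS'; [exact: Fin|exact: Fout].
Qed.

Lemma filterSpace_continuous (T : topologicalType) (f : T -> filterSpace L) :
  (forall a, clopen (f @^-1` stone_set a)) -> continuous f.
Proof.
move=> fcl t; apply: filterSpace_cvg => a fta.
  by have [o _] := fcl a; exact: open_nbhs_nbhs.
by have [_ c] := fcl a; apply: open_nbhs_nbhs; split => //; exact: closed_openC.
Qed.

(** An ultrafilter [F] converges to the filter of those [a] such that
    [stone_set a] belongs to [F]. *)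
Lemma filterSpace_compact : compact [set: filterSpace L].
Proof.
rewrite compact_ultra => F FU _.
have xP : proper_filter [set a | F (stone_set a)].
  apply: proper_filter_intro => [|a b|a b|] /=.
  - by apply: filterS filterT => x _; exact: filterSpace_top.
  - by move=> Fa ab; apply: filterS Fa => x xa; exact: filterSpace_up ab.
  - move=> Fa Fb; apply: filterS (filterI Fa Fb) => x [xa xb].
    exact: filterSpace_meet.
  - move=> F0; apply: (@filter_not_empty _ F).
    by apply: filterS F0 => x /filterSpace_bot.
exists (mk_filterSpace xP); split => //; apply: filterSpace_cvg => // a nFa.
by case: (in_ultra_setVsetC (stone_set a) FU).
Qed.

Lemma filterSpace_hausdorff : hausdorff_space (filterSpace L).
Proof.
move=> x y xy; apply/filterSpace_inj/seteqP; split => a.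
  move=> xa; apply: contrapT => ya.
  have [o c] := stone_set_clopen a.
  have [z [za]] := xy _ _ (open_nbhs_nbhs (conj o xa))
    (open_nbhs_nbhs (conj (closed_openC c) ya)).
  exact.
move=> ya; apply: contrapT => xa.
have [o c] := stone_set_clopen a.
have [z [za]] := xy _ _ (open_nbhs_nbhs (conj (closed_openC c) xa))
  (open_nbhs_nbhs (conj o ya)).
exact: za.
Qed.

End FilterSpaceOrderTopology.

(** * Orthogonality of filters *)

(** If all members were nonempty, the family would generate a proper filter,
    and any of its cluster points would lie in every member. *)
Lemma compact_directed_closed (T : topologicalType) (I : Type) (D : set I)
    (B : I -> set T) :
  compact [set: T] -> D !=set0 ->
  (forall i j, D i -> D j -> exists2 k, D k & B k `<=` B i `&` B j) ->
  (forall i, D i -> closed (B i)) ->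
  \bigcap_(i in D) B i = set0 -> exists2 i, D i & B i = set0.
Proof.
move=> cT [i0 Di0] dir cB B0; apply: contrapT => nB.
have PF : ProperFilter (filter_from D B).
  apply: filter_from_proper.
    by apply: filter_from_filter dir; exists i0.
  move=> i Di; apply: contrapT => Bi; apply: nB; exists i => //.
  by apply: contrapT => /eqP/set0P.
have [t [_ tcl]] := cT _ PF filterT.
suff : (\bigcap_(i in D) B i) t by rewrite B0.
move=> i Di; apply: (cB _ Di) => C tC.
by apply: tcl tC; exists i.
Qed.

Section FilterOrthospace.
Context {d : Order.disp_t} {L : ortholatticeType d}.
Implicit Types (x y z : filterSpace L) (a b : L).

Definition fs_perp x y := exists2 a, x a & y (ocompl a).

Lemma fs_perp_irr x : ~ fs_perp x x.
Proof.
move=> [a xa xa']; apply: (@filterSpace_bot _ _ x).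
by rewrite -(meet_ocompl a); exact: filterSpace_meet.
Qed.

Lemma fs_perp_sym x y : fs_perp x y -> fs_perp y x.
Proof. by move=> [a xa ya]; exists (ocompl a); rewrite ?ocomplK. Qed.

HB.instance Definition _ :=
  isOrthoframe.Build (filterSpace L) fs_perp_irr fs_perp_sym.

(** A filter orthogonal to all of [stone_set a] is orthogonal to the principal
    filter of [a], hence contains the orthocomplement of some [b] above [a].
    The principal filter of bottom is not proper, but then the claim holds
    because every filter contains the top. *)
Lemma orthoc_stone_set a : orthoc (stone_set a) = stone_set (ocompl a).
Proof.
apply/seteqP; split => [y ya|y ya' x xa]; last by exists a.
have [->|/eqP a0] := eqVneq a \bot.
  by rewrite ocompl_bot; exact: filterSpace_top.
have [b /= ab yb] := ya (mk_filterSpace (proper_filter_up a0)) (lexx a).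
by apply: filterSpace_up yb _; exact: le_ocompl.
Qed.

Lemma stone_set_clopen_biorth a : clopen_biorth (stone_set a).
Proof.
split; first exact: stone_set_clopen.
by rewrite /biorth_closed !orthoc_stone_set ocomplK.
Qed.

Lemma stone_set_le a b : (stone_set a `<=` stone_set b) <-> a <= b.
Proof.
split=> [ab|ab x xa]; last exact: filterSpace_up ab.
have [->|/eqP a0] := eqVneq a \bot; first exact: le0x.
exact: (ab (mk_filterSpace (proper_filter_up a0)) (lexx a)).
Qed.

Lemma stone_set_inj : injective (@stone_set _ L).
Proof.
move=> a b ab; apply/le_anti/andP.
by split; apply/stone_set_le; rewrite ab.
Qed.

(** If [y] is orthogonal to each point of [U], each point of [U] lies in some
    [stone_set a] with [ocompl a] in [y].  The sets [stone_set a] with this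
    property form a directed family, since [ocompl] turns joins into meets, so
    by compactness a single [a] works for all of [U]. *)
Lemma orthoc_separation (U : set (filterSpace L)) y : closed U ->
  orthoc U y -> exists2 a, U `<=` stone_set a & y (ocompl a).
Proof.
move=> cU Uy.
have [||||a ya Ua] := @compact_directed_closed _ _ [set a | y (ocompl a)]
    (fun a => U `&` ~` stone_set a)%classic filterSpace_compact.
- by exists \bot; rewrite /= ocompl_bot; exact: filterSpace_top.
- move=> a b ya yb; exists (a `|` b).
    by rewrite /= ocompl_join; exact: filterSpace_meet.
  move=> x [Ux xab]; split; split => // xc; apply: xab.
    exact: filterSpace_up xc (leUl _ _).
  exact: filterSpace_up xc (leUr _ _).
- move=> a _; apply: closedI => //; apply: open_closedC.
  by have [] := stone_set_clopen a.
- apply/seteqP; split => // x xP.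
  have [Ux _] := xP \bot (eq_ind_r y (filterSpace_top y) ocompl_bot).
  have [a xa ya] := Uy x Ux.
  by have [_] := xP a ya; apply.
exists a => // x Ux; apply: contrapT => xa.
by have : (U `&` ~` stone_set a)%classic x by []; rewrite Ua.
Qed.

(** By [orthoc_separation] a closed bi-orthogonally closed [U] is the
    intersection of the [stone_set a] containing it; the complement of [U] is
    compact, because [U] is open, so one [a] suffices. *)
Lemma clopen_biorth_stone_set (U : set (filterSpace L)) :
  clopen_biorth U -> exists a, U = stone_set a.
Proof.
move=> [[oU cU] bU].
have [||||a Ua aU] := @compact_directed_closed _ _
    [set a | U `<=` stone_set a] (fun a => stone_set a `&` ~` U)%classic
    filterSpace_compact.
- by exists \top => x _; exact: filterSpace_top.
- move=> a b Ua Ub; exists (a `&` b).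
    by move=> x Ux; apply: filterSpace_meet; [exact: Ua|exact: Ub].
  move=> x [xab nUx]; split; split => //.
    exact: filterSpace_up xab (leIl _ _).
  exact: filterSpace_up xab (leIr _ _).
- move=> a _; apply: closedI; last exact: open_closedC.
  by have [] := stone_set_clopen a.
- apply/seteqP; split => // x xP.
  have [] := xP \top (fun y _ => filterSpace_top y); move=> _; apply.
  rewrite bU => y Uy; have [a Ua ya] := orthoc_separation cU Uy.
  by have [xa _] := xP a Ua; apply: perp_sym; exists a.
exists a; apply/seteqP; split => // x xa; apply: contrapT => nUx.
by have : (stone_set a `&` ~` U)%classic x by []; rewrite aU.
Qed.

Lemma fs_orthospace_sep x y : ~ (x <= y) ->
  exists U : set (filterSpace L), [/\ clopen_biorth U, U x & ~ U y].
Proof.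
move=> xy; apply: contrapT => nU; apply/xy/fs_leP => a xa.
apply: contrapT => ya; apply: nU; exists (stone_set a); split => //.
exact: stone_set_clopen_biorth.
Qed.

Lemma fs_le_perp x y z : perp x z -> x <= y -> perp y z.
Proof. by move=> [a xa za] /fs_leP xy; exists a => //; exact: xy. Qed.

Lemma fs_orthoc (U : set (filterSpace L)) :
  clopen_biorth U -> clopen_biorth (orthoc U).
Proof.
move=> /clopen_biorth_stone_set[a ->]; rewrite orthoc_stone_set.
exact: stone_set_clopen_biorth.
Qed.

Lemma fs_orthospace_perp x y : perp x y ->
  exists U : set (filterSpace L), [/\ clopen_biorth U, U x & orthoc U y].
Proof.
move=> [a xa ya]; exists (stone_set a); split => //.
  exact: stone_set_clopen_biorth.
by rewrite orthoc_stone_set.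
Qed.

HB.instance Definition _ := isOrthospace.Build set_display (filterSpace L)
  filterSpace_compact fs_orthospace_sep fs_le_perp fs_orthoc
  fs_orthospace_perp.

Definition stone a : clopenBiorth (filterSpace L) :=
  mk_clopenBiorth (stone_set_clopen_biorth a).

Lemma stone_inj : injective stone.
Proof. by move=> a b /(congr1 (@cb_set _ _)); exact: stone_set_inj. Qed.

Lemma stone_surj U : exists a, stone a = U.
Proof.
have [a Ua] := clopen_biorth_stone_set (clopenBiorthP U).
by exists a; apply: clopenBiorth_inj.
Qed.

Lemma stone_meet a b : stone (a `&` b) = stone a `&` stone b.
Proof.
apply/clopenBiorth_inj/seteqP; split=> x.
  by move=> xab; split; apply: filterSpace_up xab _; rewrite ?leIl ?leIr.
by move=> [xa xb]; exact: filterSpace_meet.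
Qed.

Lemma stone_ocompl a : stone (ocompl a) = ocompl (stone a).
Proof. by apply: clopenBiorth_inj; rewrite /= orthoc_stone_set. Qed.

(** As all members of the lattice are of the form [stone a], a filter [F] on
    it is determined by its preimage under [stone], and that preimage is the
    required point. *)
Lemma filterSpace_sober : ortho_sober (filterSpace L).
Proof.
move=> F FP; have xP : proper_filter [set a | F (stone a)].
  have stone0 : stone \bot = \bot.
    by apply/clopenBiorth_inj/seteqP; split => // x /filterSpace_bot.
  have stone1 : stone \top = \top.
    by apply/clopenBiorth_inj/seteqP; split => // x _; exact: filterSpace_top.
  apply: proper_filter_intro => [|a b|a b|] /=.
  - by rewrite stone1; exact: proper_filter_top.
  - move=> Fa ab; apply: (pfilter_up FP Fa); apply/cb_leP.
    exact/stone_set_le.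
  - by move=> Fa Fb; rewrite stone_meet; exact: pfilter_meet.
  - by rewrite stone0; exact: proper_filter_bot.
exists (mk_filterSpace xP); apply/seteqP.
by split=> U; have [a <-] := stone_surj U.
Qed.

End FilterOrthospace.

(** * The accessibility relation of the filter space *)

Section FilterMonadicOrthospace.
Context {d : Order.disp_t} {L : monadicOrtholatticeType d}.
Implicit Types (x y z : filterSpace L) (a b : L).

Definition fs_acc x y := forall a, x a -> y (quant a).

Lemma fs_acc_refl x : fs_acc x x.
Proof. by move=> a xa; apply: filterSpace_up xa (le_quant a). Qed.

Lemma fs_acc_trans x y z : fs_acc x y -> fs_acc y z -> fs_acc x z.
Proof. by move=> xy yz a /xy /yz; rewrite quant_idem. Qed.

(** This is the least filter accessible from [x]. *)
Lemma quant_filter_proper x :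
  proper_filter [set b | exists2 a, x a & quant a <= b].
Proof.
apply: proper_filter_intro => [|b c [a xa ab] bc|b c [a xa ab] [a' xa' ac]|].
- by exists \top; [exact: filterSpace_top|exact: lex1].
- by exists a => //; exact: le_trans bc.
- exists (a `&` a'); first exact: filterSpace_meet.
  rewrite lexI; apply/andP; split.
    by apply: le_trans ab; apply: quant_homo; exact: leIl.
  by apply: le_trans ac; apply: quant_homo; exact: leIr.
- move=> [a xa a0]; apply: (@filterSpace_bot _ _ x).
  by apply: filterSpace_up xa _; exact: le_trans (le_quant a) a0.
Qed.

(** Orthogonality passes to larger filters, so it suffices to be orthogonal to
    the least filter accessible from [x]. *)
Lemma orthoc_acc_set1 x y :
  orthoc (rel_image fs_acc [set x]) y <->
  exists2 a, x a & y (ocompl (quant a)).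
Proof.
split=> [xy|[a xa ya] z [_ -> xz]]; last first.
  by exists (quant a) => //; exact: xz.
have [|b [a xa ab] yb] := xy (mk_filterSpace (quant_filter_proper x)).
  by exists x => // a xa; exists a.
by exists a => //; apply: filterSpace_up yb _; exact: le_ocompl.
Qed.

Lemma fs_acc_orthoc x :
  rel_image fs_acc (orthoc (rel_image fs_acc [set x])) `<=`
  orthoc (rel_image fs_acc [set x]).
Proof.
move=> z [y /orthoc_acc_set1[a xa ya] yz]; apply/orthoc_acc_set1.
by exists a => //; move: (yz _ ya); rewrite quant_ocompl_quant.
Qed.

HB.instance Definition _ := isMonadicOrthoframe.Build (filterSpace L)
  fs_acc_refl fs_acc_trans fs_acc_orthoc.

(** If [quant a] is in [y], then [y] is accessible from the principal filter of
    [a] because [quant] is monotone. *)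
Lemma acc_stone_set a :
  rel_image acc (stone_set a) = stone_set (quant a) :> set (filterSpace L).
Proof.
apply/seteqP; split=> [y [x xa]|y ya]; first exact.
have a0 : a <> \bot.
  move=> a0; move: ya; rewrite a0 /stone_set/= quant_bot.
  exact: filterSpace_bot.
exists (mk_filterSpace (proper_filter_up a0)); first exact: lexx.
by move=> b ab; apply: filterSpace_up ya _; exact: quant_homo.
Qed.

Lemma fs_acc_clopen_biorth (U : set (filterSpace L)) :
  clopen_biorth U -> clopen_biorth (rel_image acc U).
Proof.
move=> /clopen_biorth_stone_set[a ->]; rewrite acc_stone_set.
exact: stone_set_clopen_biorth.
Qed.

HB.instance Definition _ :=
  isMonadicOrthospace.Build set_display (filterSpace L) fs_acc_clopen_biorth.

End FilterMonadicOrthospace.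

(** * The quantifier on clopen bi-orthogonally closed sets *)

Section ClopenBiorthMonadic.
Context {d : Order.disp_t} {X : monadicOrthospaceType d}.
Implicit Types U V : clopenBiorth X.

Definition cb_quant U : clopenBiorth X :=
  mk_clopenBiorth (acc_clopen_biorth _ (clopenBiorthP U)).

Lemma cb_quant_homo : {homo cb_quant : U V / U <= V}.
Proof.
by move=> U V /cb_leP UV; apply/cb_leP => y [x /UV Vx xy]; exists x.
Qed.

Lemma cb_le_quant U : U <= cb_quant U.
Proof. by apply/cb_leP => x Ux; exists x => //; exact: acc_refl. Qed.

Lemma cb_quant_idem U : cb_quant (cb_quant U) = cb_quant U.
Proof.
apply/le_anti; rewrite cb_le_quant andbT; apply/cb_leP => z [y [x Ux xy] yz].
by exists x => //; exact: acc_trans yz.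
Qed.

(** If [U] is stable under [acc], all points accessible from a point [x] of [U]
    lie in [U], so [orthoc U] consists of points orthogonal to all of them; by
    the frame axiom, points accessible from [orthoc U] remain orthogonal to
    them, and in particular to [x]. *)
Lemma cb_quant_ocompl U : cb_quant U = U -> cb_quant (ocompl U) = ocompl U.
Proof.
move=> clU; apply/le_anti; rewrite cb_le_quant andbT.
apply/cb_leP => y [z Uz zy] x Ux.
apply: (@acc_orthoc _ x y _ x); last by exists x => //; exact: acc_refl.
exists z => // w [_ -> xw]; apply: Uz.
by rewrite -clU; exists x.
Qed.

HB.instance Definition _ := isMonadicOrtholattice.Build set_display
  (clopenBiorth X) cb_quant_homo cb_le_quant cb_quant_idem cb_quant_ocompl.

End ClopenBiorthMonadic.

(** * Morphisms *)

Section MonadicOrtholatticeMorphisms.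
Context {d d' : Order.disp_t}.
Context {L : monadicOrtholatticeType d} {M : monadicOrtholatticeType d'}.
Variable f : L -> M.

(** Joins and bounds are expressible by meets and orthocomplements. *)
Lemma mol_morphism_intro : Order.meet_morphism f ->
  {morph f : a / ocompl a} -> {morph f : a / quant a} ->
  monadic_ortholattice_morphism f.
Proof.
move=> fI fC fQ.
have f0 : f \bot = \bot by rewrite -(meet_ocompl \bot) fI fC meet_ocompl.
split=> // [a b|]; last by rewrite -ocompl_bot fC f0 ocompl_bot.
by apply: (can_inj ocomplK); rewrite -fC !ocompl_join fI !fC.
Qed.

Lemma mol_morphism_le : monadic_ortholattice_morphism f ->
  {homo f : a b / a <= b}.
Proof. by move=> fP a b /meet_idPl ab; rewrite -ab (mol_meet fP) leIr. Qed.

End MonadicOrtholatticeMorphisms.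

Lemma mol_morphism_can d d' (L : monadicOrtholatticeType d)
    (M : monadicOrtholatticeType d') (f : L -> M) (g : M -> L) :
  monadic_ortholattice_morphism f ->
  cancel f g -> cancel g f -> monadic_ortholattice_morphism g.
Proof.
move=> fP fK gK; apply: mol_morphism_intro => [a b|a|a];
  apply: (can_inj fK); rewrite gK.
- by rewrite (mol_meet fP) !gK.
- by rewrite (mol_ocompl fP) gK.
- by rewrite (mol_quant fP) gK.
Qed.

Section DualOfLatticeMorphism.
Context {d d' : Order.disp_t}.
Context {L : monadicOrtholatticeType d} {M : monadicOrtholatticeType d'}.
Variables (f : L -> M) (fP : monadic_ortholattice_morphism f).

Lemma preimage_proper_filter (x : filterSpace M) :
  proper_filter [set a | x (f a)].
Proof.
apply: proper_filter_intro => [|a b xa ab|a b xa xb|] /=.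
- by rewrite (mol_top fP); exact: filterSpace_top.
- by apply: filterSpace_up xa _; exact: mol_morphism_le.
- by rewrite (mol_meet fP); exact: filterSpace_meet.
- by rewrite (mol_bot fP); exact: filterSpace_bot.
Qed.

Definition filter_preimage (x : filterSpace M) : filterSpace L :=
  mk_filterSpace (preimage_proper_filter x).

(** The witness is the filter [Q] generated by the image of [x]: its preimage
    contains [x], and so lies in the bi-orthogonal closure of [x].  If [b] were
    in [Q] and [ocompl b] in [p], with [f a <= b] and [a] in [x], then
    [f (ocompl a)] would be in [p], making [x] orthogonal to the preimage of
    [p]. *)
Lemma filter_preimage_back (x : filterSpace L) (p : filterSpace M) :
  ~ perp x (filter_preimage p) ->
  exists2 q, ~ perp q p & orthoc (orthoc [set x]) (filter_preimage q).
Proof.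
move=> xp; pose Q := [set b | exists2 a, x a & f a <= b].
have Qp b : Q b -> ~ p (ocompl b).
  move=> [a xa ab] pb; apply: xp; exists a => //=; rewrite /= (mol_ocompl fP).
  by apply: filterSpace_up pb _; exact: le_ocompl.
(* [Q] is proper because the orthocomplement of bottom, that is the top, *)
(* belongs to [p]. *)
have QP : proper_filter Q.
  apply: proper_filter_intro => [|b c [a xa ab] bc|b c [a xa ab] [a' xa' ac]|].
  - by exists \top; [exact: filterSpace_top|exact: lex1].
  - by exists a => //; exact: le_trans bc.
  - exists (a `&` a'); first exact: filterSpace_meet.
    by rewrite (mol_meet fP) leI2.
  - by move=> /Qp; rewrite ocompl_bot; apply; exact: filterSpace_top.
exists (mk_filterSpace QP); first by move=> [b /Qp].
move=> y /(_ x erefl) xy; apply: perp_sym; apply: fs_le_perp xy _.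
by apply/fs_leP => a xa; exists a.
Qed.

Lemma filter_preimage_morphism : monadic_orthospace_morphism filter_preimage.
Proof.
split; first split.
- by apply: filterSpace_continuous => a; exact: (stone_set_clopen (f a)).
- move=> p q [a pa qa]; exists (f a) => //.
  by rewrite -(mol_ocompl fP).
- exact: filter_preimage_back.
- move=> U /clopen_biorth_stone_set[a ->].
  (* The preimage of [stone_set a] is by definition [stone_set (f a)]. *)
  rewrite [RHS](congr1 _ (acc_stone_set a)) [LHS](acc_stone_set (f a)).
  by rewrite -(mol_quant fP).
Qed.

End DualOfLatticeMorphism.

Section DualOfSpaceMorphism.
Context {d d' : Order.disp_t}.
Context {X : monadicOrthospaceType d} {Y : monadicOrthospaceType d'}.
Variables (phi : X -> Y) (phiP : monadic_orthospace_morphism phi).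

Definition cb_preimage (U : clopenBiorth Y) : clopenBiorth X :=
  mk_clopenBiorth (osm_clopen_biorth (mosm_orthospace phiP) (clopenBiorthP U)).

Lemma cb_preimage_morphism : monadic_ortholattice_morphism cb_preimage.
Proof.
apply: mol_morphism_intro => [U V|U|U]; apply: clopenBiorth_inj => //=.
  apply: osm_orthoc; first exact: mosm_orthospace phiP.
  by have [] := clopenBiorthP U.
by rewrite (mosm_acc phiP)//; exact: clopenBiorthP.
Qed.

End DualOfSpaceMorphism.

(** * A lattice and the clopen sets of its filter space *)

Section StoneIsomorphism.
Context {d : Order.disp_t} {L : monadicOrtholatticeType d}.

Lemma stone_morphism : monadic_ortholattice_morphism (@stone _ L).
Proof.
apply: mol_morphism_intro => [a b|a|a].
- exact: stone_meet.
- exact: stone_ocompl.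
- by apply: clopenBiorth_inj; rewrite /= acc_stone_set.
Qed.

Lemma stone_inverse : exists g : clopenBiorth (filterSpace L) -> L,
  [/\ monadic_ortholattice_morphism g, cancel (@stone _ L) g
    & cancel g (@stone _ L)].
Proof.
pose g (U : clopenBiorth (filterSpace L)) := sval (cid (stone_surj U)).
have gK : cancel g (@stone _ L) by move=> U; exact: svalP (cid (stone_surj U)).
have stoneK : cancel (@stone _ L) g by move=> a; apply: stone_inj; exact: gK.
exists g; split => //.
exact: mol_morphism_can stone_morphism stoneK gK.
Qed.

End StoneIsomorphism.

(** * An ortho-sober space and the filters of its clopen sets *)

(** Such an [f] maps closed sets to closed sets, and the preimages under [g] are
    the images under [f]. *)
Lemma compact_hausdorff_can_continuous (S T : topologicalType)
    (f : S -> T) (g : T -> S) :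
  compact [set: S] -> hausdorff_space T -> continuous f ->
  cancel f g -> cancel g f -> continuous g.
Proof.
move=> cS hT cf fK gK; apply/continuous_closedP => Z cZ.
suff -> : g @^-1` Z = f @` Z.
  apply: compact_closed => //; apply: continuous_compact.
    exact: continuous_subspaceT.
  exact: subclosed_compact cS _.
apply/seteqP; split => [t Zt|_ [s Zs <-]]; first by exists (g t).
by rewrite /= fK.
Qed.

Section PointFilter.
Context {d : Order.disp_t} {X : orthospaceType d}.
Implicit Types (x y : X) (U : clopenBiorth X).

Lemma point_filter_proper x :
  proper_filter [set U : clopenBiorth X | (U : set X) x].
Proof.
apply: proper_filter_intro => // [U V Ux /cb_leP]; exact.
Qed.

Definition point_filter x : filterSpace (clopenBiorth X) :=
  mk_filterSpace (point_filter_proper x).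

Lemma point_filter_inj : injective point_filter.
Proof.
suff le x y : point_filter x = point_filter y -> x <= y.
  by move=> x y xy; apply: le_anti; rewrite !le.
move=> xy; apply: contrapT => /orthospace_sep[U [cU Ux Uy]].
apply: Uy.
suff : point_filter y (mk_clopenBiorth cU) by [].
by rewrite -xy.
Qed.

Lemma point_filter_perp x y :
  perp (point_filter x) (point_filter y) <-> perp x y.
Proof.
split=> [[U Ux Uy]|/orthospace_perp[U [cU Ux Uy]]]; first exact: Uy.
by exists (mk_clopenBiorth cU).
Qed.

Lemma point_filter_continuous : continuous point_filter.
Proof.
by apply: filterSpace_continuous => U; have [] := clopenBiorthP U.
Qed.

Lemma point_filter_surj : ortho_sober X ->
  forall F, exists x, point_filter x = F.
Proof.
move=> sX F; have [x Fx] := sX _ (filterSpaceP F).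
by exists x; apply: filterSpace_inj; rewrite Fx.
Qed.

End PointFilter.

Section PointFilterIsomorphism.
Context {d : Order.disp_t} {X : monadicOrthospaceType d}.
Hypothesis sX : ortho_sober X.

Definition filter_point (F : filterSpace (clopenBiorth X)) : X :=
  sval (cid (point_filter_surj sX F)).

Lemma filter_pointK : cancel filter_point point_filter.
Proof. by move=> F; exact: svalP (cid (point_filter_surj sX F)). Qed.

Lemma point_filterK : cancel point_filter filter_point.
Proof. by move=> x; apply: point_filter_inj; exact: filter_pointK. Qed.

(** The inverse of [point_filter] thus matches every clopen bi-orthogonally
    closed set with a subbasic one, whose image under [acc] is known from
    [acc_stone_set]. *)
Lemma filter_point_preimage (U : clopenBiorth X) :
  filter_point @^-1` U = stone_set U.
Proof.
apply/seteqP; split=> F /= UF.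
  by rewrite /stone_set /= -(filter_pointK F).
by move: UF; rewrite /stone_set /= -{1}(filter_pointK F).
Qed.

Lemma point_filter_morphism : monadic_orthospace_morphism (@point_filter _ X).
Proof.
split; first split.
- exact: point_filter_continuous.
- by move=> x y /point_filter_perp.
- move=> F x Fx; exists (filter_point F).
    by move=> /point_filter_perp; rewrite filter_pointK.
  by rewrite filter_pointK; exact: sub_orthoc2.
- move=> _ /clopen_biorth_stone_set[U ->].
  by rewrite acc_stone_set.
Qed.

Lemma filter_point_morphism : monadic_orthospace_morphism filter_point.
Proof.
split; first split.
- apply: (compact_hausdorff_can_continuous _ filterSpace_hausdorff).
  + exact: orthospace_compact.
  + exact: point_filter_continuous.
  + exact: point_filterK.
  + exact: filter_pointK.
- by move=> F G /point_filter_perp; rewrite !filter_pointK.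
- move=> x F xF; exists (point_filter x).
    by rewrite -[F]filter_pointK => /point_filter_perp.
  by rewrite point_filterK; exact: sub_orthoc2.
- move=> U cU; rewrite (filter_point_preimage (mk_clopenBiorth cU)).
  rewrite acc_stone_set.
  exact: esym (filter_point_preimage (quant (mk_clopenBiorth cU))).
Qed.

End PointFilterIsomorphism.

(** * The dual equivalence *)

Lemma sval_ext (A B : Type) (P : (A -> B) -> Prop) (f g : {f | P f}) :
  sval f =1 sval g -> f = g.
Proof.
by case: f g => [f fP] [g gP] /= /funext fg; exact: eq_exist.
Qed.

Local Notation sober_mOS :=
  (full_subcategory (fun X : mOS => ortho_sober (mOS_sort X))).

(** Taking the opposite of [mOL] as source makes the preimage functors
    covariant. *)
Definition filter_functor_ob (L : opposite mOL) : sober_mOS :=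
  exist (fun X : mOS => ortho_sober (mOS_sort X))
    (@MOSOb set_display (filterSpace (mOL_sort L)))
    (@filterSpace_sober _ (mOL_sort L)).

Definition filter_functor_hom (L M : opposite mOL) (f : cat_hom L M) :
    cat_hom (filter_functor_ob L) (filter_functor_ob M) :=
  exist _ (filter_preimage (svalP f)) (filter_preimage_morphism (svalP f)).

Definition filter_functor : functor (opposite mOL) sober_mOS.
Proof.
apply: (@Functor _ _ filter_functor_ob filter_functor_hom) => [L|L M N g f].
  by apply: sval_ext => x; exact: filterSpace_inj.
by apply: sval_ext => x; exact: filterSpace_inj.
Defined.

Definition clopen_functor_ob (X : sober_mOS) : opposite mOL :=
  @MOLOb set_display (clopenBiorth (mOS_sort (sval X))).

Definition clopen_functor_hom (X Y : sober_mOS) (phi : cat_hom X Y) :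
    cat_hom (clopen_functor_ob X) (clopen_functor_ob Y) :=
  exist _ (cb_preimage (svalP phi)) (cb_preimage_morphism (svalP phi)).

Definition clopen_functor : functor sober_mOS (opposite mOL).
Proof.
apply: (@Functor _ _ clopen_functor_ob clopen_functor_hom) => [X|X Y Z psi phi].
  by apply: sval_ext => U; exact: clopenBiorth_inj.
by apply: sval_ext => U; exact: clopenBiorth_inj.
Defined.

Lemma stone_natural : naturally_isomorphic
  (functor_comp clopen_functor filter_functor) (functor_id (opposite mOL)).
Proof.
exists (fun L => exist _ (@stone _ (mOL_sort L)) stone_morphism).
split=> [L|L M f].
  have [g [gP stoneK gK]] := @stone_inverse _ (mOL_sort L).
  exists (exist _ g gP).
  by split; apply: sval_ext => ?; [exact: gK|exact: stoneK].
by apply: sval_ext => a; exact: clopenBiorth_inj.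
Qed.

Lemma point_filter_natural : naturally_isomorphic
  (functor_comp filter_functor clopen_functor) (functor_id sober_mOS).
Proof.
exists (fun X => exist _ (filter_point (svalP X))
  (filter_point_morphism (svalP X))).
split=> [X|X Y phi].
  exists (exist _ (@point_filter _ _) (point_filter_morphism (svalP X))).
  split; apply: sval_ext => ?; [exact: filter_pointK|exact: point_filterK].
apply: sval_ext => F; rewrite -[F](filter_pointK (svalP X)) /=.
apply: point_filter_inj; rewrite filter_pointK point_filterK.
exact: filterSpace_inj.
Qed.

Theorem corollary5p9 :
  dually_equivalent mOL
    (full_subcategory (fun X : mOS => ortho_sober (mOS_sort X))).
Proof.
exists filter_functor, clopen_functor.
by split; [exact: stone_natural|exact: point_filter_natural].
Qed.
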